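(* Let $\Gamma$ be a finite connected bipartite graph with ordered bipartition $(B|B')$, let $G\leq\mathrm{Aut}(\Gamma)$, let $1\neq N\lhd G$, and let $r\geq 3$ be an integer. Suppose that the following two conditions hold: (a) $\Gamma$ is $r$-starlike relative to $N$, and $\Gamma$ is locally $(G,4)$-distance transitive; (b) the adjacency design $\mathcal{D}(\Gamma)$ is $G$-pairwise transitive and $N$-nicely affine with $r$ parallel classes of blocks. Then $G^B\cong G$ (that is, $G$ acts faithfully on $B$) and $G^B$ has rank $2$ or $3$; $G^{B'}\cong G$ (that is, $G$ acts faithfully on $B'$) and $G^{B'}$ is imprimitive of rank $3$; and for every $x\in B$, $G_x^{\Gamma(x)}$ is $2$-transitive of degree $r$.
   Context: All graphs are finite, simple and without loops. (Conditions (a) and (b) are the equivalent conditions characterised in the paper.) For a $G$-invariant (or $G_x$-invariant) set $X$, $G^X$ (or $G_x^X$) denotes the permutation group induced on $X$; the action of $G$ on $X$ is faithful if $G^X\cong G$. $\Gamma(x)$ is the set of neighbours of $x$. The rank of a transitive permutation group is the number of orbits of a point stabiliser; groups of rank $2$ are called $2$-transitive. Locally $(G,s)$-distance transitive: the graph has diameter at least $s$, $G$ is a subgroup of its automorphism group, and for each vertex $v$ and each $1\leq i\leq s$ the stabiliser $G_v$ is transitive on the set of vertices at distance $i$ from $v$. $r$-starlike: a connected bipartite graph with ordered bipartition $(B|B')$ is $r$-starlike relative to $N$ if $N\leq\mathrm{Aut}(\Gamma)$, $r\geq2$, $N$ is transitive on $B$, and $N$ has exactly $r$ orbits on $B'$.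 A design $\mathcal{D}=(\mathcal{P},\mathcal{B},\mathcal{I})$ consists of a point set, a block set and an incidence relation $\mathcal{I}\subseteq\mathcal{P}\times\mathcal{B}$. An automorphism is a permutation of $\mathcal{P}\cup\mathcal{B}$ preserving points, blocks and incidence. Two distinct points are collinear if incident with at least one common block, otherwise non-collinear; two distinct blocks are intersecting if incident with at least one common point, otherwise non-intersecting. The adjacency design $\mathcal{D}(\Gamma)$ has point set $B$, block set $B'$, with incidence given by adjacency in $\Gamma$. $G$-pairwise transitive: $G$ is a group of automorphisms of the design transitive on each of the following six (possibly empty) sets: incident and non-incident point-block pairs, collinear and non-collinear point pairs, intersecting and non-intersecting block pairs (ordered pairs of distinct elements). $N$-nicely affine: $N$ is a group of automorphisms transitive on points, and there is a constant $\mu$ such that distinct blocks are incident with exactly $\mu$ common points if they are in different $N$-orbits and with no common point if they are in the same $N$-orbit. The $N$-orbits on blocks are the parallel classes. *)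

(* Defs.v *)
From mathcomp Require Import all_boot all_fingroup all_solvable.

Set Implicit Arguments.
Unset Strict Implicit.
Unset Printing Implicit Defensive.

Local Open Scope group_scope.

Record sgraph (V : finType) := SGraph {
  adj :> rel V;
  adj_sym : symmetric adj;
  adj_irrefl : irreflexive adj
}.

Section Graphs.

Variables (V : finType) (Gamma : sgraph V).
Implicit Types (x y : V) (B : {set V}) (G N : {group {perm V}}).

Definition nbhd x : {set V} := [set y | Gamma x y].

Definition connected_graph := [forall x, forall y, connect Gamma x y].

Definition aut_graph : {set {perm V}} :=
  [set g : {perm V} | [forall x, forall y, Gamma (g x) (g y) == Gamma x y]].

(* A shortest path has length less than #|V|, so the value is #|V| exactly when
   y is not reachable from x. *)
Definition gdist x y : nat :=
  find (fun k => [exists p : k.-tuple V, path Gamma x p && (last x p == y)])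
       (iota 0 #|V|).

(* The diameter when Gamma is connected. *)
Definition diameter : nat := \max_x \max_y gdist x y.

Definition sphere i x : {set V} := [set y | gdist x y == i].

(* The test for the empty set is needed because [transitive A, on S | to] is
   false when S is empty, while a sphere of radius i <= diameter may be empty
   around some of the vertices. *)
Definition locally_distance_transitive G (s : nat) : Prop :=
  [/\ s <= diameter, G \subset aut_graph
    & forall x i, 1 <= i <= s ->
        sphere i x = set0 \/ [transitive 'C_G[x | 'P], on sphere i x | 'P]].

Definition ordered_bipartition B (B' : {set V}) : Prop :=
  [/\ B :|: B' = [set: V], [disjoint B & B']
    & forall x y, Gamma x y ->
        (x \in B) && (y \in B') || (x \in B') && (y \in B)].

Definition starlike B (B' : {set V}) (r : nat) N : Prop :=
  [/\ connected_graph /\ ordered_bipartition B B', N \subset aut_graph, 2 <= r,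
      [transitive N, on B | 'P]
    & N \subset 'N(B' | 'P) /\ #|orbit 'P N @: B'| = r].

End Graphs.

(* Points and blocks are two subsets of an ambient type T, meant to be disjoint;
   only the values of inc on points x blocks are ever used. *)
Record design (T : finType) := Design {
  points : {set T};
  blocks : {set T};
  inc : rel T
}.

Definition adjacency_design (V : finType) (Gamma : sgraph V) (B B' : {set V}) :=
  Design B B' Gamma.

Section Designs.

Variables (T : finType) (D : design T).
Implicit Types (p q b c : T) (G N : {group {perm T}}).

(* perm_on expresses that g is a permutation of the set points U blocks. *)
Definition aut_design : {set {perm T}} :=
  [set g : {perm T} |
    [&& perm_on (points D :|: blocks D) g,
        g @: points D == points D, g @: blocks D == blocks D
      & [forall p in points D, forall b in blocks D,
           inc D (g p) (g b) == inc D p b]]].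

Definition blocks_on p q : {set T} := [set b in blocks D | inc D p b && inc D q b].

Definition points_on b c : {set T} := [set p in points D | inc D p b && inc D p c].

Definition incident_pairs : {set T * T} :=
  [set u in setX (points D) (blocks D) | inc D u.1 u.2].
Definition nonincident_pairs : {set T * T} :=
  [set u in setX (points D) (blocks D) | ~~ inc D u.1 u.2].
Definition collinear_pairs : {set T * T} :=
  [set u in setX (points D) (points D) |
     (u.1 != u.2) && (blocks_on u.1 u.2 != set0)].
Definition noncollinear_pairs : {set T * T} :=
  [set u in setX (points D) (points D) |
     (u.1 != u.2) && (blocks_on u.1 u.2 == set0)].
Definition intersecting_pairs : {set T * T} :=
  [set u in setX (blocks D) (blocks D) |
     (u.1 != u.2) && (points_on u.1 u.2 != set0)].
Definition nonintersecting_pairs : {set T * T} :=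
  [set u in setX (blocks D) (blocks D) |
     (u.1 != u.2) && (points_on u.1 u.2 == set0)].

(* Holds vacuously when S is empty. *)
Definition transitive_on_pairs G (S : {set T * T}) : Prop :=
  {in S &, forall u v, exists2 g : {perm T}, g \in G & v = (g u.1, g u.2)}.

Definition pairwise_transitive G : Prop :=
  G \subset aut_design /\
  [/\ transitive_on_pairs G incident_pairs /\
        transitive_on_pairs G nonincident_pairs,
      transitive_on_pairs G collinear_pairs /\
        transitive_on_pairs G noncollinear_pairs
    & transitive_on_pairs G intersecting_pairs /\
        transitive_on_pairs G nonintersecting_pairs].

Definition nicely_affine N : Prop :=
  [/\ N \subset aut_design, [transitive N, on points D | 'P]
    & exists mu : nat, {in blocks D &, forall b c, b != c ->
        #|points_on b c| = if c \in orbit 'P N b then 0 else mu}].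

Definition parallel_classes N : {set {set T}} := orbit 'P N @: blocks D.

End Designs.

Section PermutationGroups.

Variable T : finType.
Implicit Types (G : {group {perm T}}) (X : {set T}).

(* The permutation group G^X induced on a G-invariant set X, its elements being
   extended by the identity outside X. *)
Definition induced G X : {group {perm T}} := (restr_perm X @* G)%G.

Definition has_rank G X k : Prop :=
  [transitive G, on X | 'P] /\
  {in X, forall x, #|orbit 'P 'C_G[x | 'P] @: X| = k}.

Definition imprimitive G X : bool :=
  [transitive G, on X | 'P] && [exists Q, imprimitivity_system G X 'P Q].

End PermutationGroups.

(* Main.v *)
(* N is transitive on points, so every point lies on exactly one block of each parallel class;
   hence two distinct blocks are disjoint exactly when they are parallel. The block graph
   is thus complete multipartite with the N-orbits as parts, which gives the imprimitive rank 3
   action on blocks; on points, collinearity and non-collinearity give rank 2 or 3. Each class has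
   at least two blocks, for otherwise transitivity makes Gamma complete bipartite, of diameter
   at most 2. Locally at a point p, the blocks on p correspond to the classes, which G
   permutes 2-transitively with N acting trivially, and G = N G_p. *)
Require Import Defs.
From mathcomp Require Import all_boot all_fingroup all_solvable.

Local Open Scope group_scope.

(** * Groups induced on an invariant set: transitivity, faithfulness and rank *)

Section InducedAction.

Variables (T : finType) (G : {group {perm T}}) (X : {set T}).
Hypothesis nXG : G \subset 'N(X | 'P).

Lemma restr_perm_in (g : {perm T}) (x : T) :
  g \in G -> x \in X -> restr_perm X g x = g x.
Proof. by move=> Gg Xx; rewrite restr_permE ?(subsetP nXG). Qed.

Lemma inducedP (h : {perm T}) :
  reflect (exists2 g, g \in G & h = restr_perm X g) (h \in induced G X).
Proof.
apply: (iffP morphimP) => [[g _ Gg ->] | [g Gg ->]]; exists g => //.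
exact: subsetP nXG g Gg.
Qed.

Lemma orbit_induced : {in X, orbit 'P (induced G X) =1 orbit 'P G}.
Proof.
move=> x Xx; apply/setP=> z; apply/imsetP/imsetP => [[h /inducedP[g Gg ->] ->]|].
  by exists g => //=; rewrite !apermE restr_perm_in.
case=> g Gg ->; exists (restr_perm X g); first by apply/inducedP; exists g.
by rewrite /= !apermE restr_perm_in.
Qed.

Lemma atrans_induced :
  [transitive induced G X, on X | 'P] = [transitive G, on X | 'P].
Proof. by rewrite /atrans (eq_in_imset orbit_induced). Qed.

Lemma orbit_stab_induced : {in X &, forall x y,
  orbit 'P 'C_(induced G X)[x | 'P] y = orbit 'P 'C_G[x | 'P] y}.
Proof.
move=> x y Xx Xy; apply/setP=> z; apply/imsetP/imsetP=> [] [h].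
  case/setIP=> /inducedP[g Gg ->] /astab1P /=; rewrite apermE restr_perm_in // => gx ->.
  exists g; last by rewrite /= !apermE restr_perm_in.
  by rewrite inE Gg; apply/astab1P; rewrite /= apermE.
case/setIP=> Gh /astab1P hx ->; exists (restr_perm X h).
  rewrite inE; apply/andP; split; first by apply/inducedP; exists h.
  by apply/astab1P; rewrite /= apermE restr_perm_in.
by rewrite /= !apermE restr_perm_in.
Qed.

Lemma faithful_induced_isog : [faithful G, on X | 'P] -> induced G X \isog G.
Proof.
move=> fG; rewrite isog_sym; apply/isogP.
exists (restrm_morphism nXG (restr_perm_morphism X)).
  by rewrite ker_restrm ker_restr_perm.
by rewrite morphim_restrm setIid.
Qed.

Lemma induced_norm : induced G X \subset 'N(X | 'P).
Proof.
apply/subsetP=> h /inducedP[g Gg ->]; apply/astabsP=> x.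
by rewrite /= apermE (perm_closed _ (restr_perm_on X g)).
Qed.

(** Bridges transitivity on ordered pairs, as it comes from designs, to transitivity on
    [2.-dtuple(X)]; the bound on [#|X|] provides the base tuple. *)
Lemma ntransitive2_induced :
    1 < #|X| ->
    (forall a b c d, a \in X -> b \in X -> c \in X -> d \in X ->
       a != b -> c != d -> exists2 g : {perm T}, g \in G & g a = c /\ g b = d) ->
  [transitive^2 induced G X, on X | 'P].
Proof.
case/card_gt1P=> a [b] [Xa Xb neq_ab] tr2.
have Xab: [tuple a; b] \in 2.-dtuple(X).
  by rewrite !inE /= inE neq_ab subset_all /= Xa Xb.
apply/imsetP; exists [tuple a; b] => //; apply/setP=> u.
apply/idP/imsetP=> [|[h Xh ->]]; last first.
  by apply: n_act_dtuple => //; apply: (subsetP induced_norm).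
case/tupleP: u => c u; case/tupleP: u => d u; rewrite (tuple0 u) {u}.
rewrite inE subset_all /= inE !andbT => /and3P[neq_cd Xc Xd].
have [g Gg [ga gb]] := tr2 a b c d Xa Xb Xc Xd neq_ab neq_cd.
exists (restr_perm X g); first by apply/inducedP; exists g.
by apply/val_inj; rewrite /= !apermE !restr_perm_in // ga gb.
Qed.

Lemma has_rank_induced k :
    [transitive G, on X | 'P] ->
    {in X, forall x, #|orbit 'P 'C_G[x | 'P] @: X| = k} ->
  has_rank (induced G X) X k.
Proof.
move=> trG rkG; split=> [|x Xx]; first by rewrite atrans_induced.
rewrite -(rkG x Xx); congr #|pred_of_set _|; apply: eq_in_imset => y Xy.
exact: orbit_stab_induced.
Qed.

(** With [e] saying that [blocks_on] or [points_on] is empty, this set and the one for the negated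
    relation are convertible to the sets of (non-)collinear and (non-)intersecting pairs. *)
Definition distinct_pairs (e : rel T) : {set T * T} :=
  [set u in setX X X | (u.1 != u.2) && e u.1 u.2].

Definition distinct_from (e : rel T) (x : T) : {set T} :=
  [set y in X | (x != y) && e x y].

Definition invariant_rel (e : rel T) : Prop :=
  forall g : {perm T}, g \in G -> {in X &, forall x y, e (g x) (g y) = e x y}.

Lemma mem_invariant (g : {perm T}) (x : T) : g \in G -> (g x \in X) = (x \in X).
Proof. by move=> /(subsetP nXG)/astabsP/(_ x). Qed.

(** [G] can move any related pair so that its first entry becomes [x], so emptiness at one point
    decides emptiness everywhere. *)
Lemma distinct_from_eq0 (e : rel T) (x : T) :
    [transitive G, on X | 'P] -> invariant_rel e -> x \in X ->
  (distinct_from e x == set0) = (distinct_pairs e == set0).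
Proof.
move=> trG eG Xx; apply/eqP/eqP=> [E0|S0]; last first.
  apply/setP=> y; have := in_set0 (x, y).
  by rewrite -S0 !inE /= Xx.
apply/setP=> -[a b]; rewrite in_set0 !inE /=.
apply/negP=> /and3P[/andP[Xa Xb] neq_ab eab].
have [g Gg gx] := atransP2 trG Xa Xx; rewrite /= apermE in gx.
have := in_set0 (g b); rewrite -E0 inE mem_invariant // Xb /= gx.
by rewrite (inj_eq perm_inj) neq_ab eG ?eab.
Qed.

(** A permutation carrying [(x, y)] to [(x, z)] fixes [x]. *)
Lemma orbit_stab_distinct_from (e : rel T) (x y : T) :
    invariant_rel e -> transitive_on_pairs G (distinct_pairs e) ->
    x \in X -> y \in distinct_from e x ->
  orbit 'P 'C_G[x | 'P] y = distinct_from e x.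
Proof.
move=> eG tr_e Xx; rewrite inE => /and3P[Xy neq_xy exy]; apply/setP=> z.
apply/imsetP/idP=> [[g /setIP[Gg /astab1P /= gx] ->]|].
  rewrite apermE in gx; rewrite inE /= apermE mem_invariant // Xy.
  by rewrite -{1 2}gx (inj_eq perm_inj) neq_xy eG.
rewrite inE => /and3P[Xz neq_xz exz].
have [||g Gg [gx gy]] := tr_e (x, y) (x, z).
- by rewrite !inE /= Xx Xy neq_xy.
- by rewrite !inE /= Xx Xz neq_xz.
by exists g => //; rewrite inE Gg; apply/astab1P; apply/esym.
Qed.

(** The stabiliser of [x] has as orbits [[set x]], the other elements related to [x], and the
    remaining ones; the two boolean summands record which of the last two are nonempty. *)
Lemma has_rank_of_rel (e : rel T) :
    [transitive G, on X | 'P] -> invariant_rel e ->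
    transitive_on_pairs G (distinct_pairs e) ->
    transitive_on_pairs G (distinct_pairs (fun x y => ~~ e x y)) ->
  has_rank (induced G X) X
    (1 + (distinct_pairs e != set0)
       + (distinct_pairs (fun x y => ~~ e x y) != set0)).
Proof.
move=> trG eG tr_e; set e' := fun x y => ~~ e x y => tr_e'.
have e'G: invariant_rel e' by move=> g Gg x y Xx Xy; rewrite /e' eG.
apply: has_rank_induced => // x Xx.
rewrite -!(distinct_from_eq0 _ x) //.
set E := distinct_from e x; set F := distinct_from e' x.
set f := orbit _ _.
have defX: X = x |: (E :|: F).
  apply/setP=> y; rewrite !inE; have [-> | neq_xy] := eqVneq y x; first exact: Xx.
  by rewrite /e' /=; case: (e x y); rewrite /= ?andbT ?andbF ?orbF.
have fx: f x = [set x] by apply/orbit1P/afixP=> g /setIP[_ /astab1P].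
have fE y : y \in E -> f y = E by apply: orbit_stab_distinct_from.
have fF y : y \in F -> f y = F by apply: orbit_stab_distinct_from.
(* The orbit map is constant on [E] and on [F], with the set itself as value, so each contributes
   one orbit, or none if it is empty. *)
have imf (A : {set T}) : (forall y, y \in A -> f y = A) ->
    f @: A = if A == set0 then set0 else [set A].
  case: eqP => [-> | /eqP/set0Pn[y Ay]] fA; first by rewrite imset0.
  apply/setP=> C; rewrite inE; apply/imsetP/eqP=> [[z Az ->]|->]; first exact: fA.
  by exists y; rewrite ?fA.
rewrite {1}defX !imsetU imset_set1 fx (imf E fE) (imf F fF).
have xE: x \notin E by rewrite inE eqxx andbF.
have xF: x \notin F by rewrite inE eqxx andbF.
have neq_x (A : {set T}) : x \notin A -> ([set x] == A) = false.
  by move=> xA; apply/eqP=> eqA; rewrite -eqA set11 in xA.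
have EF: E != set0 -> (E == F) = false.
  case/set0Pn=> y; rewrite inE => /and3P[Xy neq exy]; apply/eqP=> /setP/(_ y).
  by rewrite !inE /e' Xy neq exy.
case: (eqVneq E set0) EF => [E0|_] EF; case: (eqVneq F set0) => [F0|_];
  rewrite ?setU0 ?set0U ?cards1 ?cards2 ?neq_x //.
by rewrite cardsU1 !inE !neq_x // cards2 EF.
Qed.

End InducedAction.

(** * Imprimitivity from the orbits of a normal subgroup *)

Lemma imset_orbit_norm (T : finType) (N : {group {perm T}}) (g : {perm T}) (x : T) :
  g \in 'N(N) -> g @: orbit 'P N x = orbit 'P N (g x).
Proof.
move=> nNg; apply/setP=> w; rewrite -[w](permKV g) mem_imset; last exact: perm_inj.
by rewrite -{2}(normP nNg) -!apermE orbit_conjsg.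
Qed.

(** Normality makes [G] permute the orbits of [N]; having several orbits, one of them with two
    points, excludes the trivial partitions. *)
Lemma imprimitive_induced (T : finType) (G N : {group {perm T}}) (X : {set T}) :
    G \subset 'N(X | 'P) -> N <| G -> [transitive G, on X | 'P] ->
    1 < #|orbit 'P N @: X| ->
    (exists x y, [/\ x \in X, y \in X, y \in orbit 'P N x & y != x]) ->
  imprimitive (induced G X) X.
Proof.
move=> nXG /andP[sNG nNG] trG ltQ [x [y [Xx Xy Nxy neq_yx]]].
rewrite /imprimitive atrans_induced // trG; apply/existsP.
exists (orbit 'P N @: X); apply/and3P; split.
- by apply: orbit_partition; apply: subset_trans sNG nXG.
- apply/subsetP=> _ /inducedP-/(_ nXG)[g Gg ->].
  rewrite !inE; apply/subsetP=> _ /imsetP[z Xz ->].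
  rewrite inE; apply/imsetP; exists (g z); first by rewrite (mem_invariant _ _ _ nXG).
  rewrite -imset_orbit_norm ?(subsetP nNG) //; apply: eq_in_imset => w Nw.
  rewrite /= apermE (restr_perm_in _ _ _ nXG) //; apply: subsetP Nw.
  by rewrite acts_sub_orbit // (subset_trans sNG nXG).
(* As many orbits as points would make the orbit map injective, against [x] and [y] sharing an
   orbit. *)
rewrite ltQ ltn_neqAle leq_imset_card andbT; apply/imset_injP=> inj.
case/eqP: neq_yx; apply: inj => //; exact/orbit_eqP.
Qed.

(** * Automorphisms of designs *)

Section DesignAutomorphisms.

Variables (T : finType) (D : design T) (g : {perm T}).
Hypothesis autg : g \in aut_design D.

Lemma aut_design_on : perm_on (points D :|: blocks D) g.
Proof. by move: autg; rewrite inE => /and4P[]. Qed.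

Lemma aut_design_points x : (g x \in points D) = (x \in points D).
Proof.
move: autg; rewrite inE => /and4P[_ /eqP<- _ _].
rewrite mem_imset; last exact: perm_inj.
by move: autg; rewrite inE => /and4P[_ /eqP-> _ _].
Qed.

Lemma aut_design_blocks x : (g x \in blocks D) = (x \in blocks D).
Proof.
move: autg; rewrite inE => /and4P[_ _ /eqP<- _].
rewrite mem_imset; last exact: perm_inj.
by move: autg; rewrite inE => /and4P[_ _ /eqP-> _].
Qed.

Lemma aut_design_inc :
  {in points D & blocks D, forall p b, inc D (g p) (g b) = inc D p b}.
Proof.
move=> p b Pp Qb; move: autg; rewrite inE => /and4P[_ _ _].
by move/forall_inP/(_ p Pp)/forall_inP/(_ b Qb)/eqP.
Qed.

Lemma aut_design_points_on :
  {in blocks D &, forall b c, points_on D (g b) (g c) = g @: points_on D b c}.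
Proof.
move=> b c Qb Qc; apply/setP=> p; rewrite -[p](permKV g) mem_imset; last exact: perm_inj.
rewrite !inE aut_design_points; case Pp: (_ \in points D) => //=.
by rewrite !aut_design_inc.
Qed.

Lemma aut_design_blocks_on :
  {in points D &, forall p q, blocks_on D (g p) (g q) = g @: blocks_on D p q}.
Proof.
move=> p q Pp Pq; apply/setP=> b; rewrite -[b](permKV g) mem_imset; last exact: perm_inj.
rewrite !inE aut_design_blocks; case Qb: (_ \in blocks D) => //=.
by rewrite !aut_design_inc.
Qed.

End DesignAutomorphisms.

(** * Pairwise transitive, nicely affine designs *)

Section NicelyAffine.

Variables (T : finType) (D : design T) (G N : {group {perm T}}).
Hypothesis nNG : N <| G.
Hypothesis trD : pairwise_transitive D G.
Hypothesis affD : nicely_affine D N.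
Hypothesis three_classes : 3 <= #|parallel_classes D N|.
Hypothesis block_nonempty :
  {in blocks D, forall b, exists2 p, p \in points D & inc D p b}.
Hypothesis not_complete : nonincident_pairs D != set0.

Local Notation P := (points D).
Local Notation Q := (blocks D).
Local Notation class := (orbit 'P N).

Let autG g : g \in G -> g \in aut_design D.
Proof. by case: trD => /subsetP sG _; apply: sG. Qed.

Let sNG n : n \in N -> n \in G.
Proof. exact: subsetP (normal_sub nNG) n. Qed.

Let norm_setP (R : {set T}) :
  (forall g, g \in G -> forall x, (g x \in R) = (x \in R)) -> G \subset 'N(R | 'P).
Proof. by move=> RG; apply/subsetP=> g Gg; apply/astabsP=> x; apply: RG. Qed.

Lemma acts_points : G \subset 'N(P | 'P).
Proof. by apply: norm_setP => g /autG; apply: aut_design_points. Qed.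

Lemma acts_blocks : G \subset 'N(Q | 'P).
Proof. by apply: norm_setP => g /autG; apply: aut_design_blocks. Qed.

Lemma points_transitive : [transitive G, on P | 'P].
Proof.
case: affD => _ trN _.
by rewrite (atrans_supgroup (normal_sub nNG) trN) acts_points.
Qed.

Lemma exists_block : exists b, b \in Q.
Proof.
apply/set0Pn; apply: contraTneq three_classes => Q0.
by rewrite /parallel_classes Q0 imset0 cards0.
Qed.

(** Every block carries a point, so two blocks extend to incident pairs, on which [G] is
    transitive. *)
Lemma blocks_transitive2 : {in Q &, forall b c, exists2 g, g \in G & g b = c}.
Proof.
move=> b c Qb Qc; have [p Pp pb] := block_nonempty b Qb.
have [q Pq qc] := block_nonempty c Qc.
case: trD => _ [[tr _] _ _].
have [||g Gg [_ gb]] := tr (p, b) (q, c); rewrite ?inE /= ?Pp ?Pq ?Qb ?Qc //.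
by exists g.
Qed.

Lemma blocks_transitive : [transitive G, on Q | 'P].
Proof.
have [b Qb] := exists_block; apply/imsetP; exists b => //; apply/setP=> c.
apply/idP/imsetP=> [Qc | [g Gg ->]].
  by have [g Gg gb] := blocks_transitive2 b c Qb Qc; exists g.
by rewrite /= apermE aut_design_blocks ?autG.
Qed.

(** * Parallel classes and intersections of blocks *)

Lemma class_block (b c : T) : b \in Q -> c \in class b -> c \in Q.
Proof.
move=> Qb /imsetP[n Nn ->].
by rewrite /= apermE aut_design_blocks ?autG ?sNG.
Qed.

Lemma class_meets (p b : T) :
  p \in P -> b \in Q -> exists2 c, c \in class b & inc D p c.
Proof.
move=> Pp Qb; have [q Pq qb] := block_nonempty b Qb.
case: affD => _ trN _; have [n Nn ->] := atransP2 trN Pq Pp.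
exists (n b); first by apply: mem_orbit.
by rewrite /= apermE aut_design_inc ?autG ?sNG.
Qed.

Lemma parallel_eq (p b c : T) :
  p \in P -> b \in Q -> c \in class b -> inc D p b -> inc D p c -> b = c.
Proof.
move=> Pp Qb bc pb pc; apply/eqP/negPn/negP=> neq_bc.
case: affD => _ _ [mu /(_ b c Qb (class_block b c Qb bc) neq_bc)].
by rewrite bc => /eqP; rewrite cards_eq0 => /eqP/setP/(_ p); rewrite !inE Pp pb pc.
Qed.

(** The point is that [mu] is positive: a point of [b] lies on some block [c'] parallel to [c], so
    [b] and [c'] have [mu] common points and at least one. *)
Lemma nonparallel_meet (b c : T) :
  b \in Q -> c \in Q -> c \notin class b -> points_on D b c != set0.
Proof.
move=> Qb Qc nbc; have [p Pp pb] := block_nonempty b Qb.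
have [c' cc' pc'] := class_meets p c Pp Qc.
have Qc' := class_block c c' Qc cc'.
have neq c1 : c1 \notin class b -> b != c1.
  by apply: contraNneq => <-; apply: orbit_refl.
have nbc' : c' \notin class b.
  by apply: contra nbc => bc'; apply: orbit_trans bc'; rewrite orbit_sym.
case: affD => _ _ [mu muP].
rewrite -cards_eq0 muP ?neq // (negbTE nbc).
have := muP b c' Qb Qc' (neq _ nbc'); rewrite (negbTE nbc') => <-.
by rewrite cards_eq0; apply/set0Pn; exists p; rewrite inE Pp pb.
Qed.

Lemma points_on_eq0 (b c : T) :
  b \in Q -> c \in Q -> b != c -> (points_on D b c == set0) = (c \in class b).
Proof.
move=> Qb Qc neq_bc; have [bc|nbc] := boolP (c \in class b); last first.
  exact/negbTE/nonparallel_meet.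
by case: affD => _ _ [mu /(_ b c Qb Qc neq_bc)]; rewrite bc -cards_eq0 => ->.
Qed.

(** [G] moves a non-incident pair to one whose block is [b]; the block of the class of [b] through
    the resulting point cannot be [b]. *)
Lemma class_nontrivial (b : T) : b \in Q -> exists2 c, c \in class b & c != b.
Proof.
move=> Qb; case: (set0Pn _ not_complete) => -[p c]; rewrite !inE /=.
case/andP=> /andP[Pp Qc] npc.
have [g Gg gc] := blocks_transitive2 c b Qc Qb.
have Pgp: g p \in P by rewrite aut_design_points ?autG.
have [d bd gpd] := class_meets (g p) b Pgp Qb.
exists d => //; apply: contraNneq npc => eq_db.
by rewrite -(aut_design_inc _ _ _ (autG g Gg)) // gc -eq_db.
Qed.

Lemma other_class (b : T) : b \in Q -> exists2 c, c \in Q & c \notin class b.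
Proof.
move=> Qb; suff /subsetPn[c Qc bc]: ~~ (Q \subset class b) by exists c.
apply: contraL three_classes => /subsetP sQb; rewrite -ltnNge ltnS.
apply: leq_trans (_ : 1 <= 2) => //; rewrite -(cards1 (class b)).
apply/subset_leq_card/subsetP=> _ /imsetP[c /sQb bc ->].
by rewrite inE; apply/eqP/orbit_eqP.
Qed.

(* Let c, c' be parallel blocks and d a block of another class. A point y of d and c, a
   point z of d and c' are collinear, and c contains y but not z; transitivity on
   collinear pairs then separates all collinear pairs. *)
Lemma points_separated (p q : T) : p \in P -> q \in P -> p != q ->
  exists2 b, b \in Q & inc D p b && ~~ inc D q b.
Proof.
move=> Pp Pq neq_pq.
have [s0|] := eqVneq (blocks_on D p q) set0.
  have [b Qb] := exists_block; have [c bc pc] := class_meets p b Pp Qb.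
  have Qc := class_block b c Qb bc; exists c => //; rewrite pc.
  by apply/negP=> qc; have := in_set0 c; rewrite -s0 !inE Qc pc qc.
move=> coll; have [c Qc] := exists_block; have [c' cc' neq_cc'] := class_nontrivial c Qc.
have [d Qd cd] := other_class c Qc; have Qc' := class_block c c' Qc cc'.
have /set0Pn[y] := nonparallel_meet c d Qc Qd cd; rewrite inE => /and3P[Py yc yd].
have c'd: d \notin class c' by apply: contra cd => c'd; apply: orbit_trans cc'.
have /set0Pn[z] := nonparallel_meet c' d Qc' Qd c'd; rewrite inE => /and3P[Pz zc' zd].
have nzc: ~~ inc D z c.
  by apply: contra neq_cc' => zc; rewrite eq_sym (parallel_eq z c c').
have neq_yz: y != z by apply: contraNneq nzc => <-.
case: trD => _ [_ [tr _] _]; have [||g Gg [-> ->]] := tr (y, z) (p, q).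
- rewrite !inE /= Py Pz neq_yz; apply/set0Pn; exists d; by rewrite inE Qd yd.
- by rewrite !inE /= Pp Pq neq_pq.
exists (g c); first by rewrite aut_design_blocks ?autG.
by rewrite !aut_design_inc ?autG // yc.
Qed.

(** Distinct parallel blocks are disjoint. In the other case [b] meets a second block [c'] parallel
    to [c], and a common point of [b] and [c'] is not on [c]. *)
Lemma blocks_separated (b c : T) : b \in Q -> c \in Q -> b != c ->
  exists2 p, p \in P & inc D p b && ~~ inc D p c.
Proof.
move=> Qb Qc neq_bc; have [bc|nbc] := boolP (c \in class b).
  have [p Pp pb] := block_nonempty b Qb; exists p => //; rewrite pb.
  by apply: contraNN neq_bc => pc; rewrite (parallel_eq p b c).
have [c' cc' neq_cc'] := class_nontrivial c Qc; have Qc' := class_block c c' Qc cc'.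
have nbc': c' \notin class b.
  by apply: contra nbc => bc'; apply: orbit_trans bc'; rewrite orbit_sym.
have /set0Pn[p] := nonparallel_meet b c' Qb Qc' nbc'; rewrite inE => /and3P[Pp pb pc'].
exists p => //; rewrite pb; apply: contra neq_cc' => pc.
by rewrite eq_sym (parallel_eq p c c').
Qed.

(** * Faithfulness on blocks and on points *)

Let stab_all_eq1 g : g \in G ->
  {in P, forall p, g p = p} -> {in Q, forall b, g b = b} -> g = 1.
Proof.
move=> Gg gP gQ; apply/permP=> x; rewrite perm1.
case: (boolP (x \in P :|: Q)) => [/setUP[]|]; [exact: gP | exact: gQ |].
exact: out_perm (aut_design_on _ _ _ (autG g Gg)).
Qed.

(** If [g] fixes every block, then [p] and [g p] lie on the same blocks, which [points_separated]
    allows only when they are equal. *)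
Lemma faithful_blocks : [faithful G, on Q | 'P].
Proof.
apply/faithfulP=> g Gg gQ; have {}gQ: {in Q, forall b, g b = b} by apply: gQ.
apply: stab_all_eq1 => // p Pp; apply/eqP/negPn/negP=> neq.
have Pgp: g p \in P by rewrite aut_design_points ?autG.
have [b Qb /andP[gpb]] := points_separated _ _ Pgp Pp neq.
by rewrite -(aut_design_inc _ _ _ (autG g Gg)) // (gQ b) // gpb.
Qed.

Lemma faithful_points : [faithful G, on P | 'P].
Proof.
apply/faithfulP=> g Gg gP; have {}gP: {in P, forall p, g p = p} by apply: gP.
apply: stab_all_eq1 => // b Qb; apply/eqP/negPn/negP=> neq.
have Qgb: g b \in Q by rewrite aut_design_blocks ?autG.
have [p Pp /andP[pgb]] := blocks_separated _ _ Qgb Qb neq.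
by rewrite -(aut_design_inc _ _ _ (autG g Gg)) // (gP p) // pgb.
Qed.

(** * Rank and imprimitivity on points and on blocks *)

Lemma points_rank : has_rank (induced G P) P 2 \/ has_rank (induced G P) P 3.
Proof.
case: trD => _ [_ [trc trn] _].
have inv: invariant_rel T G P (fun p q => blocks_on D p q == set0).
  by move=> g Gg p q Pp Pq; rewrite aut_design_blocks_on ?autG // imset_eq0.
have := has_rank_of_rel T G P acts_points _ points_transitive inv trn trc.
set S := distinct_pairs _ _ _; set S' := distinct_pairs _ _ _.
case: (boolP (S == set0)) => [/eqP S0|]; case: (boolP (S' == set0)) => [/eqP S'0|]; auto.
(* Only the case where both relations are empty is left, which would mean a single point; points on
   two distinct parallel blocks refute it. *)
have [b Qb] := exists_block; have [c bc neq_cb] := class_nontrivial b Qb.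
have [p Pp pb] := block_nonempty b Qb.
have [q Pq qc] := block_nonempty c (class_block b c Qb bc).
have neq_pq: p != q.
  by apply: contraNneq neq_cb => eq_pq; rewrite eq_sym (parallel_eq p b c) // eq_pq.
have := in_set0 (p, q); rewrite -{1}S0; have := in_set0 (p, q); rewrite -{1}S'0.
by rewrite !inE /= Pp Pq neq_pq; case: (_ == _).
Qed.

(** Distinct blocks have no common point exactly when they are parallel, and both parallel and
    non-parallel pairs exist, so both summands equal one. *)
Lemma blocks_rank : has_rank (induced G Q) Q 3.
Proof.
case: trD => _ [_ _ [tri trn]].
have inv: invariant_rel T G Q (fun b c => points_on D b c == set0).
  by move=> g Gg b c Qb Qc; rewrite aut_design_points_on ?autG // imset_eq0.
have := has_rank_of_rel T G Q acts_blocks _ blocks_transitive inv trn tri.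
have [b Qb] := exists_block; have [c bc neq_cb] := class_nontrivial b Qb.
have [d Qd bd] := other_class b Qb.
have neq_bd : b != d by apply: contraNneq bd => <-; apply: orbit_refl.
have Qc := class_block b c Qb bc.
rewrite (_ : distinct_pairs _ _ _ != set0); last first.
  apply/set0Pn; exists (b, c); rewrite !inE /= Qb Qc eq_sym neq_cb.
  by rewrite points_on_eq0 // eq_sym.
rewrite (_ : distinct_pairs _ _ _ != set0) //.
by apply/set0Pn; exists (b, d); rewrite !inE /= Qb Qd neq_bd points_on_eq0.
Qed.

Lemma blocks_imprimitive : imprimitive (induced G Q) Q.
Proof.
apply: imprimitive_induced acts_blocks nNG blocks_transitive _ _.
  exact: leq_trans three_classes.
have [b Qb] := exists_block; have [c bc neq_cb] := class_nontrivial b Qb.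
by exists b, c; split=> //; apply: class_block bc.
Qed.

(** * The local action at a point *)

Lemma card_blocks_at (p : T) :
  p \in P -> #|[set b in Q | inc D p b]| = #|parallel_classes D N|.
Proof.
(* Sending a block on [p] to its class is onto by [class_meets] and injective by [parallel_eq]. *)
move=> Pp; rewrite -(card_in_imset (f := class)).
  congr #|pred_of_set _|; apply/setP=> A; apply/imsetP/imsetP=> [] [b].
    by rewrite inE => /andP[Qb _] ->; exists b.
  move=> Qb ->; have [c bc pc] := class_meets p b Pp Qb.
  exists c; first by rewrite inE pc (class_block b).
  by apply/esym/orbit_eqP.
move=> b c; rewrite !inE => /andP[Qb pb] /andP[Qc pc] eq_bc.
by apply: (parallel_eq p) => //; apply/orbit_eqP.
Qed.

(* Each class has one block at p, so N fixes the classes while G permutes them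
   2-transitively; as N is transitive on points, an element of G can be corrected by one
   of N to fix p. *)
Lemma stab_transitive2 (p a b c d : T) : p \in P ->
    a \in Q -> b \in Q -> c \in Q -> d \in Q ->
    inc D p a -> inc D p b -> inc D p c -> inc D p d -> a != b -> c != d ->
  exists2 g : {perm T}, g \in 'C_G[p | 'P] & g a = c /\ g b = d.
Proof.
move=> Pp Qa Qb Qc Qd pa pb pc pd neq_ab neq_cd.
case: trD => _ [_ _ [tr _]]; have [||g Gg [/= gc gd]] := tr (a, b) (c, d).
- by rewrite !inE /= Qa Qb neq_ab; apply/set0Pn; exists p; rewrite inE Pp pa.
- by rewrite !inE /= Qc Qd neq_cd; apply/set0Pn; exists p; rewrite inE Pp pc.
have Pgp: g p \in P by rewrite aut_design_points ?autG.
case: affD => _ trN _; have [n Nn /= np] := atransP2 trN Pgp Pp.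
have Gn := sNG n Nn; exists (g * n).
  by rewrite inE groupM //=; apply/astab1P; rewrite /= apermE permM.
(* The blocks [y] and [n y] are parallel and both contain [p], hence they coincide. *)
have fix_at x y : x \in Q -> y \in Q ->
      y = g x -> inc D p x -> inc D p y -> (g * n) x = y.
  move=> Qx Qy yE px py; rewrite permM -yE; apply/esym/(parallel_eq p) => //.
    exact: mem_orbit.
  by rewrite np apermE aut_design_inc ?autG // yE aut_design_inc ?autG.
by split; apply: fix_at.
Qed.

End NicelyAffine.

(** * Distances in complete bipartite graphs *)

Section BipartiteGraphs.

Variables (V : finType) (Gamma : sgraph V) (B B' : {set V}).

Lemma gdist_le_path (x : V) (p : seq V) :
  path Gamma x p -> gdist Gamma x (last x p) <= size p.
Proof.
move=> pathp; rewrite /gdist; set a := fun _ => _; set s := iota _ _.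
(* A path of length at least [#|V|] is outside the searched range, but [find] never exceeds the
   length of the list, which is [#|V|]. *)
have [lt_p|] := ltnP (size p) #|V|; last first.
  by apply: leq_trans; apply: leq_trans (find_size _ _) _; rewrite size_iota.
rewrite leqNgt; apply/negP=> /(before_find 0); rewrite nth_iota // add0n => /negbT/negP; apply.
by apply/existsP; exists (in_tuple p); rewrite /= pathp eqxx.
Qed.

(** Two vertices on one side are joined through a fixed vertex of the other side; as [path] allows
    repetitions, this also covers two equal vertices. *)
Lemma complete_bipartite_diameter :
    ordered_bipartition Gamma B B' -> B != set0 -> B' != set0 ->
    {in B & B', forall x y, Gamma x y} ->
  diameter Gamma <= 2.
Proof.
case=> defV _ _ /set0Pn[x0 Bx0] /set0Pn[y0 By0] complete.
apply/bigmax_leqP=> x _; apply/bigmax_leqP=> y _.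
have part z : (z \in B) || (z \in B') by rewrite -in_setU defV.
have complete' u v : u \in B' -> v \in B -> Gamma u v.
  by move=> B'u Bv; rewrite adj_sym complete.
case/orP: (part x) => Hx; case/orP: (part y) => Hy.
- by apply: (gdist_le_path x [:: y0; y]); rewrite /= complete ?complete'.
- by apply: leq_trans (gdist_le_path x [:: y] _) _; rewrite //= complete.
- by apply: leq_trans (gdist_le_path x [:: y] _) _; rewrite //= complete'.
- by apply: (gdist_le_path x [:: x0; y]); rewrite /= complete' ?complete.
Qed.

Lemma connected_has_nbr (x y : V) :
  connected_graph Gamma -> x != y -> exists z, Gamma x z.
Proof.
move=> /forallP/(_ x)/forallP/(_ y)/connectP[[|z p] /= pathp ->].
  by rewrite eqxx.
by move=> _; exists z; case/andP: pathp.
Qed.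

End BipartiteGraphs.

(** * Application to the adjacency design *)

Theorem theorem1p5 (V : finType) (Gamma : sgraph V) (B B' : {set V})
    (G N : {group {perm V}}) (r : nat) :
  connected_graph Gamma ->
  ordered_bipartition Gamma B B' ->
  G \subset aut_graph Gamma ->
  N :!=: 1 -> N <| G ->
  3 <= r ->
  (* (a) *)
  starlike Gamma B B' r N ->
  locally_distance_transitive Gamma G 4 ->
  (* (b) *)
  pairwise_transitive (adjacency_design Gamma B B') G ->
  nicely_affine (adjacency_design Gamma B B') N ->
  #|parallel_classes (adjacency_design Gamma B B') N| = r ->
  [/\ (* action on B *)
      [/\ induced G B \isog G, [faithful G, on B | 'P]
        & has_rank (induced G B) B 2 \/ has_rank (induced G B) B 3],
      (* action on B' *)
      [/\ induced G B' \isog G, [faithful G, on B' | 'P],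
          imprimitive (induced G B') B' & has_rank (induced G B') B' 3]
    & (* local action at the vertices of B *)
      {in B, forall x,
         [transitive^2 induced 'C_G[x | 'P]%G (nbhd Gamma x), on nbhd Gamma x | 'P]
         /\ #|nbhd Gamma x| = r}].
Proof.
set D := adjacency_design Gamma B B'.
move=> conn bip sGA _ nNG le3r _ [le4d _ _] trD affD card_classes.
have [defV disj edge] := bip.
have B'0: B' != set0.
  apply: contraTneq le3r => B'0.
  by rewrite -card_classes /parallel_classes /= B'0 imset0 cards0.
(* Transitivity on a set says that the set is the orbit of one of its members, so it supplies a
   vertex of [B]. *)
have [x0 Bx0]: exists x0, x0 \in B.
  by case: affD => _ /imsetP[x0 Bx0 _] _; exists x0.
have notB' x : x \in B -> x \in B' = false by apply: disjointFr disj.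
have notB x : x \in B' -> x \in B = false by apply: disjointFl disj.
have three: 3 <= #|parallel_classes D N| by rewrite card_classes.
(* A vertex [y] of [B'] differs from [x0], so connectedness gives it a neighbour, which
   bipartiteness places in [B]. *)
have nonempty: {in blocks D, forall b, exists2 p, p \in points D & inc D p b}.
  move=> y /= B'y; have [|z yz] := connected_has_nbr V Gamma y x0 conn.
    by apply: contraTneq B'y => ->; rewrite notB'.
  exists z; last by rewrite adj_sym.
  by have := edge y z yz; rewrite notB // B'y.
have ncomplete: nonincident_pairs D != set0.
  apply/eqP=> S0; suff le2d: diameter Gamma <= 2 by have := leq_trans le4d le2d.
  apply: (complete_bipartite_diameter V Gamma B B') => //.
    by apply/set0Pn; exists x0.
  move=> x y Bx B'y; apply: contraT => nxy; have := in_set0 (x, y).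
  by rewrite -S0 !inE /= Bx B'y nxy.
have fB: [faithful G, on B | 'P] by apply: (faithful_points V D G N).
have fB': [faithful G, on B' | 'P] by apply: (faithful_blocks V D G N).
have nB := acts_points V D G trD.
have nB' := acts_blocks V D G trD.
split; first split=> //.
- exact: faithful_induced_isog.
- exact: (points_rank V D G N).
- split=> //; first exact: faithful_induced_isog.
  + exact: (blocks_imprimitive V D G N).
  + exact: (blocks_rank V D G N).
move=> x Bx.
have nbhdE: nbhd Gamma x = [set b in blocks D | inc D x b].
  apply/setP=> y; rewrite !inE /=; case xy: (Gamma x y); rewrite ?andbF ?andbT //.
  by have := edge x y xy; rewrite Bx (notB' x Bx) orbF.
have card_nbhd: #|nbhd Gamma x| = r.
  by rewrite nbhdE (card_blocks_at V D G N).
split=> //; apply: ntransitive2_induced.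
(* An automorphism of the graph that fixes [x] preserves its neighbourhood. *)
- apply/subsetP=> g /setIP[Gg /astab1P /= gx]; apply/astabsP=> y.
  rewrite /= apermE in gx *; rewrite !inE -{1}gx.
  by have := subsetP sGA g Gg; rewrite inE => /forallP/(_ x)/forallP/(_ y)/eqP.
- by rewrite card_nbhd ltnW.
move=> a b c d; rewrite nbhdE !inE.
move=> /andP[Qa xa] /andP[Qb xb] /andP[Qc xc] /andP[Qd xd] neq_ab neq_cd.
exact: (stab_transitive2 V D G N).
Qed.
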